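(* Let $G=(V,E)$ be a finite simple graph. Then $$Sb_2(G)\le \min\{\deg(u)+\deg(v)+\deg(s)+\deg(t)-2\},$$ where the minimum is taken over all sets $\{u,v,s,t\}\subseteq V$ of four vertices such that $uv,st\in E$ and the subgraph induced on $\{u,v,s,t\}$ has exactly two edges.
   Context: $\gamma(G)$ is the domination number of $G$ (minimum size of a dominating set). $Sb_2(G)$ is the minimum size of a set $\mathcal{E}\subseteq E$ such that $\gamma(G-\mathcal{E})=\gamma(G)+2$. *)

(* Defs.v *)
From HB Require Import structures.
From mathcomp Require Import all_boot all_order all_algebra.
From mathcomp Require Import constructive_ereal.
Set Implicit Arguments. Unset Strict Implicit. Unset Printing Implicit Defensive.
Import Order.TTheory GRing.Theory Num.Theory.

Record sgraph (V : finType) := SGraph {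
  edges : {set {set V}};
  edges_card2 : {in edges, forall f : {set V}, #|f| = 2} }.

Section Graphs.
Variable V : finType.
Implicit Types (G : sgraph V) (A : {set V}) (F : {set {set V}}).

(* No vertex is adjacent to itself, since [set x; x] has only one element. *)
Definition adj G (x y : V) : bool := [set x; y] \in edges G.

Definition deg G (x : V) : nat := #|[set y | adj G x y]|.

Lemma del_edges_card2 G F :
  {in edges G :\: F, forall f : {set V}, #|f| = 2}.
Proof. by move=> f /setDP[fG _]; apply: (edges_card2 fG). Qed.

Definition del_edges G F : sgraph V := SGraph (@del_edges_card2 G F).

Definition induced_edges G A : {set {set V}} :=
  [set f in edges G | f \subset A].

Definition dominating G A : bool :=
  [forall x, (x \in A) || [exists y in A, adj G x y]].

(* The witness setT is always dominating, so the minimum is attained. *)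
Definition domination_number G : nat :=
  #|[arg min_(A < [set: V] | dominating G A) #|A| ]|.

(* The minimum is taken in the extended integers; it is +oo when no set of
   edges raises the domination number by exactly k. *)
Definition Sb (k : nat) G : \bar int :=
  \big[Order.min/+oo%E]_(F : {set {set V}} |
      (F \subset edges G) &&
      (domination_number (del_edges G F) == domination_number G + k))
    (#|F|%:Z)%:E.

End Graphs.

(* Main.v *)
(** Deleting one edge raises the domination number by at most one: if the edge
    [xy] was used to dominate [x], add [x] to the dominating set.  Hence a set of
    edges whose deletion raises it by at least [k] contains one whose deletion
    raises it by exactly [k].  Delete all edges meeting [{u, v, s, t}]: these four
    vertices are now isolated, so every dominating set [D] contains them, and
    [D - {v, t}] still dominates the original graph.  Double counting incidences
    gives the number of deleted edges as the sum of the four degrees minus the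
    number of induced edges. *)
Require Import Defs.
From HB Require Import structures.
From mathcomp Require Import all_boot all_order all_algebra.
From mathcomp Require Import constructive_ereal.
From mathcomp Require Import zify.
Set Implicit Arguments. Unset Strict Implicit. Unset Printing Implicit Defensive.
Import Order.TTheory GRing.Theory Num.Theory.
Local Open Scope ring_scope.

Section DominationAfterDeletion.
Local Open Scope nat_scope.
Variable V : finType.
Implicit Types (G : sgraph V) (A D : {set V}) (F : {set {set V}}).

Definition meeting_edges G A : {set {set V}} :=
  [set f in edges G | f :&: A != set0].

Lemma adj_del_edges G F x y :
  adj (del_edges G F) x y = ([set x; y] \notin F) && adj G x y.
Proof. by rewrite /adj in_setD. Qed.

Lemma adj_neq G x y : adj G x y -> x != y.
Proof. by move=> /edges_card2; rewrite cards2; case: (x != y). Qed.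

Lemma dominatingP G D :
  reflect (forall x, x \notin D -> exists2 y, y \in D & adj G x y)
          (dominating G D).
Proof.
apply: (iffP forallP) => [H x xD|H x].
  by move: (H x); rewrite (negPf xD) => /exists_inP.
by case: (boolP (x \in D)) => //= /H [y yD xy]; apply/exists_inP; exists y.
Qed.

Lemma dominating_setT G : dominating G [set: V].
Proof. by apply/dominatingP => x; rewrite inE. Qed.

Lemma domination_number_le G D :
  dominating G D -> domination_number G <= #|D|.
Proof.
rewrite /domination_number; case: arg_minnP; first exact: dominating_setT.
by move=> A _ minA /minA.
Qed.

Lemma domination_number_witness G :
  exists2 D, dominating G D & #|D| = domination_number G.
Proof.
rewrite /domination_number; case: arg_minnP; first exact: dominating_setT.
by move=> A domA _; exists A.
Qed.

Lemma domination_number_del_edges0 G :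
  domination_number (del_edges G set0) <= domination_number G.
Proof.
have [D /dominatingP domD <-] := domination_number_witness G.
apply/domination_number_le/dominatingP => x /domD[y yD xy].
by exists y; rewrite // adj_del_edges inE.
Qed.

Lemma domination_number_del_edges1 G F e :
  e \in edges G ->
  domination_number (del_edges G F)
    <= (domination_number (del_edges G (F :\ e))).+1.
Proof.
move=> /edges_card2/eqP/cards2P[x [y [_ def_e]]].
have [D /dominatingP domD <-] :=
  domination_number_witness (del_edges G (F :\ e)).
(* Orient [e] so that [a] is the endpoint to add: if exactly one endpoint lies in [D], then [a] is
   the other one. *)
have [a [b [{}def_e abD]]] :
    exists a b, e = [set a; b] /\ (a \in D -> b \in D).
  case: (boolP (y \in D)) => yD; first by exists x, y.
  by exists y, x; split; [rewrite setUC | rewrite (negPf yD)].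
have card_aD : #|a |: D| <= #|D|.+1 by rewrite cardsU1; case: (_ \notin _).
apply: leq_trans card_aD; apply/domination_number_le/dominatingP => z.
rewrite !inE negb_or => /andP[neq_za zD].
have [w wD] := domD z zD; rewrite adj_del_edges !inE negb_and negbK.
move=> /andP[zwF zw]; exists w; first by rewrite !inE wD orbT.
(* Only the case where [z] was dominated through [e] itself remains. As [z] is not [a], this forces
   [w = a] and [z = b]; then [a] is in [D], hence so is [b], against [zD]. *)
rewrite adj_del_edges zw andbT; case/orP: zwF => // /eqP zw_e.
have : a \in [set z; w] by rewrite zw_e def_e set21.
rewrite !inE eq_sym (negPf neq_za) /= => /eqP aw.
have : z \in [set a; b] by rewrite -def_e -zw_e set21.
rewrite !inE (negPf neq_za) /= => /eqP zb.
by rewrite zb abD ?aw in zD.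
Qed.

(** Induction on [#|F|]: while the increase exceeds [k], restoring any edge of [F] costs at most
    one, so it stays at least [k]. If [F] is empty, the bound is already an equality. *)
Lemma exact_domination_increase G F k :
  F \subset edges G ->
  domination_number G + k <= domination_number (del_edges G F) ->
  exists2 F' : {set {set V}}, F' \subset F &
    domination_number (del_edges G F') = domination_number G + k.
Proof.
move En: #|F| => n; elim: n F En => [|n IHn] F cardF sFE leF.
  move/eqP: cardF; rewrite cards_eq0 => /eqP F0; subst F.
  exists set0 => //; apply/eqP; rewrite eqn_leq leF andbT.
  exact: leq_trans (domination_number_del_edges0 G) (leq_addr _ _).
move: leF; rewrite leq_eqVlt => /predU1P[eqF|ltF]; first by exists F.
have /card_gt0P[e eF] : 0 < #|F| by rewrite cardF.
have [F' sF' eqF'] : exists2 F' : {set {set V}}, F' \subset F :\ e &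
    domination_number (del_edges G F') = domination_number G + k.
  apply: IHn.
  - by move: cardF; rewrite (cardsD1 e) eF => -[].
  - exact: subset_trans (subD1set _ _) sFE.
  - rewrite -ltnS; apply: leq_trans ltF _.
    exact/domination_number_del_edges1/(subsetP sFE).
by exists F' => //; apply: subset_trans sF' (subD1set _ _).
Qed.

(** The map sending [y] to [[set x; y]] is a bijection from the neighbours of [x] to the edges
    containing [x]. *)
Lemma deg_incident_edges G x : deg G x = \sum_(f in edges G) (x \in f).
Proof.
rewrite -big_mkcondr sum1_card /deg.
rewrite -(card_in_imset (f := fun y => [set x; y])); last first.
  move=> y z; rewrite !inE => /adj_neq nxy _ /setP/(_ y).
  by rewrite !inE eqxx orbT eq_sym (negPf nxy) => /esym/eqP.
apply: eq_card => f; apply/imsetP/andP => [[y]|[fG xf]].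
  by rewrite inE => xy ->; rewrite set21.
move/eqP/cards2P: (edges_card2 fG) => [a [b [_ def_f]]]; subst f.
move: xf; rewrite !inE => /orP[]/eqP ->; first by exists b; rewrite ?inE.
by exists a; rewrite ?inE /adj 1?setUC.
Qed.

(** After exchanging sums, an edge [f] contributes [#|f :&: A|], which is 0, 1 or 2: one for meeting
    [A], and one more when both endpoints lie in [A]. *)
Lemma sum_deg G A :
  \sum_(x in A) deg G x = #|meeting_edges G A| + #|induced_edges G A|.
Proof.
rewrite (eq_bigr _ (fun x _ => deg_incident_edges G x)) exchange_big /=.
rewrite -!sum1_card /meeting_edges /induced_edges.
under [X in _ = X + _]eq_bigl do rewrite inE.
under [X in _ = _ + X]eq_bigl do rewrite inE.
rewrite !big_mkcondr -big_split; apply: eq_bigr => f /edges_card2 card_f.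
rewrite -big_mkcondr sum1_card.
have -> : #|[pred x in A | x \in f]| = #|f :&: A|.
  by apply: eq_card => x; rewrite !inE andbC.
rewrite -card_gt0 (sameP setIidPl eqP) eqEcard subsetIl card_f /=.
have := subset_leq_card (subsetIl f A); rewrite card_f.
by case: #|_| => [|[|[]]].
Qed.

Lemma not_adj_del_meeting_edges G A x y :
  (x \in A) || (y \in A) -> ~~ adj (del_edges G (meeting_edges G A)) x y.
Proof.
move=> xyA; rewrite adj_del_edges negb_and negbK orbC -implybE.
apply/implyP => xy.
rewrite inE -/(adj G x y) xy /=; apply/eqP => /setP I0.
have := I0 x; have := I0 y; rewrite !inE !eqxx orbT /=.
by case/orP: xyA => ->.
Qed.

Lemma domination_number_del_two_edges G u v s t :
  uniq [:: u; v; s; t] -> adj G u v -> adj G s t ->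
  domination_number G + 2 <=
    domination_number (del_edges G (meeting_edges G [set u; v; s; t])).
Proof.
set A := [set u; v; s; t] => uniqA uv st.
have [D /dominatingP domD <-] :=
  domination_number_witness (del_edges G (meeting_edges G A)).
have /subsetP sAD : A \subset D.
  apply/subsetP => x xA; case: (boolP (x \in D)) => // /domD[y _].
  by rewrite (negPf (not_adj_del_meeting_edges _ _)) ?xA.
have [uA vA sA tA] : [/\ u \in A, v \in A, s \in A & t \in A].
  by rewrite !inE !eqxx ?orbT.
move: uniqA; rewrite /= !inE !negb_or !andbT.
case/andP=> /and3P[uv' us ut] /andP[/andP[vs vt] st'].
have -> : #|D| = #|D :\: [set v; t]| + 2.
  rewrite -(cardsID [set v; t] D) addnC (setIidPr _) ?cards2 ?vt //.
  by apply/subsetP => x; rewrite !inE => /orP[]/eqP ->; apply: sAD.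
rewrite leq_add2r; apply/domination_number_le/dominatingP => x.
(* In [G], the removed vertices [v] and [t] are dominated by [u] and [s]. A vertex outside [D] keeps
   its dominator, which cannot be [v] or [t] because these are isolated after the deletion. *)
rewrite in_setD negb_and negbK => /orP[|xD].
  rewrite !inE => /orP[]/eqP ->.
    by exists u; rewrite ?inE ?negb_or ?uv' ?ut ?sAD // /adj setUC.
  by exists s; rewrite ?inE ?negb_or ?st' 1?eq_sym ?vs ?sAD // /adj setUC.
have [y yD xy] := domD x xD; exists y; last first.
  by move: xy; rewrite adj_del_edges => /andP[].
rewrite in_setD yD andbT; apply: contraL xy; rewrite !inE => yvt.
by apply: not_adj_del_meeting_edges; case/orP: yvt => /eqP ->; rewrite ?vA ?tA orbT.
Qed.

End DominationAfterDeletion.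

Lemma Sb_le (V : finType) (G : sgraph V) (k : nat) (F : {set {set V}}) :
  F \subset edges G ->
  (domination_number G + k <= domination_number (del_edges G F))%N ->
  (Sb k G <= (#|F|%:Z)%:E)%E.
Proof.
move=> sFE /(exact_domination_increase sFE)[F' sF'F eqF'].
have le_card : ((#|F'|%:Z)%:E <= (#|F|%:Z)%:E)%E.
  by rewrite lee_fin lez_nat subset_leq_card.
apply: le_trans le_card; apply: bigmin_le_cond.
by rewrite (subset_trans sF'F sFE) eqF' eqxx.
Qed.

Theorem theorem5 (V : finType) (G : sgraph V) :
  (Sb 2 G <=
   \big[Order.min/+oo]_(u : V) \big[Order.min/+oo]_(v : V)
   \big[Order.min/+oo]_(s : V) \big[Order.min/+oo]_(t : V |
       [&& uniq [:: u; v; s; t], [set u; v] \in edges G,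
           [set s; t] \in edges G &
           #|induced_edges G [set u; v; s; t]| == 2%N])
     ((deg G u)%:Z + (deg G v)%:Z + (deg G s)%:Z + (deg G t)%:Z - 2)%:E)%E.
Proof.
(* Each minimum starts from [+oo], so the bound must also be checked against that default. *)
apply/le_bigmin => [|u _]; first exact: leey.
apply/le_bigmin => [|v _]; first exact: leey.
apply/le_bigmin => [|s _]; first exact: leey.
apply/le_bigmin => [|t /and4P[uniqA uv st /eqP card_ind]]; first exact: leey.
set A := [set u; v; s; t] in card_ind.
(* The 2 is the number of induced edges; keeping it on the right avoids truncated subtraction. *)
have sum_degA :
    (deg G u + (deg G v + (deg G s + deg G t)) = #|meeting_edges G A| + 2)%N.
  have in_A : A =i [:: u; v; s; t] by move=> x; rewrite !inE !orbA.
  rewrite -card_ind -sum_deg (eq_bigl _ _ in_A) -big_uniq //=.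
  by rewrite !big_cons big_nil addn0.
have sAE : meeting_edges G A \subset edges G by apply/subsetP => f; case/setIdP.
apply: le_trans (Sb_le sAE (domination_number_del_two_edges uniqA uv st)) _.
by rewrite lee_fin; lia.
Qed.
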